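(* Let $n,d$ be positive integers with $n-d\ge1$, and let $\mathcal{Q}_{n,d}$ be the map from $\mathrm{SYT}(d,1^{n-d})\times\{0,1,\dots,n-d-1\}$ to $\widetilde{\mathrm{Sch}}_{n,d-1,(1)}$ defined by $\mathcal{Q}_{n,d}(\tau,i)=\Pi_{n,d-1}^i(\mathcal{S}_{n,d}(\tau))$. Then $\mathcal{Q}_{n,d}$ is a bijection. Moreover, $\mathrm{bounce}(\mathcal{Q}_{n,d}(\tau,i))=\mathrm{maj}(\tau)-\mathrm{des}(\tau)+i$ for all $\tau\in\mathrm{SYT}(d,1^{n-d})$ and all $i\in\{0,1,\dots,n-d-2\}$.
   Context: Words in $N=(0,1)$, $E=(1,0)$, $D=(1,1)$ are read as lattice paths starting at $(0,0)$. $\mathrm{Sch}_{n,d}$ is the set of Schröder paths with $d$ diagonal steps: words with $n-d$ $N$'s, $n-d$ $E$'s and $d$ $D$'s with $|\omega|_N\ge|\omega|_E$ for every prefix $\omega$. A Dyck path is a Schröder path without $D$. The area is the number of lower triangles (lower halves of unit squares cut along the diagonal from bottom left to top right corner) under the path and above the main diagonal; equivalently the sum of $y-x$ over all $N$ and $D$ steps, $(x,y)$ being the starting point of the step. $\widetilde{\mathrm{Sch}}_{n,d}$ is the set of $\gamma\in\mathrm{Sch}_{n,d}$ with no $D$ after the last $N$ (i.e. ending with $NE^k$, $k\ge1$), and $\widetilde{\mathrm{Sch}}_{n,d,(1)}$ is the set of those of area $1$. Such a path is a concatenation of blocks, exactly one of which is $NNEE$ or $NDE$ and all others $NE$ or $D$,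 the last block being $NE$ or $NNEE$. $\{NE,D\}^*$ is the set of all concatenations of blocks $NE$ and $D$, and $\{NE,D\}^*NE$ those whose last block is $NE$. Bounce: for a Dyck path of size $k$ ($k$ north steps), the bounce path starts at $(0,0)$, goes north until it reaches the starting point of an east step of the Dyck path, then east until it reaches the main diagonal, then north again, and so on until $(k,k)$; its bounce is the sum of $k-j$ over all points $(j,j)$, $1\le j\le k$, at which the bounce path returns to the main diagonal. For a Schröder path $\gamma$, let $\Gamma(\gamma)$ be the Dyck path obtained by deleting all $D$ steps. The points where the bounce path of $\Gamma(\gamma)$ turns from north to east are starting points of east steps of $\Gamma(\gamma)$; the corresponding east steps of $\gamma$ are the peak steps. $\mathrm{numph}(\gamma)$ is the sum over all $D$ steps of the number of peak steps preceding that $D$ step in the word, and $\mathrm{bounce}(\gamma)=\mathrm{bounce}(\Gamma(\gamma))+\mathrm{numph}(\gamma)$. $\mathrm{SYT}(\lambda)$: standard Young tableaux of shape $\lambda$ (French notation). $\mathrm{Des}(\tau)$ is the set of entries $i$ with $i+1$ in a strictly higher row; $\mathrm{des}(\tau)=|\mathrm{Des}(\tau)|$ and $\mathrm{maj}(\tau)=\sum_{i\in\mathrm{Des}(\tau)}i$. For $\tau\in\mathrm{SYT}(d,1^{n-d})$, $\mathcal{S}_{n,d}(\tau)=\gamma_\tau=\gamma_1\gamma_2\cdots\gamma_{n-1}$, where for $1\le i\le n-1$: $\gamma_{n-i}=NNEE$ if $i=\max\mathrm{Des}(\tau)$ and $1\in\mathrm{Des}(\tau)$; $\gamma_{n-i}=NDE$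 if $i=\max\mathrm{Des}(\tau)$ and $1\notin\mathrm{Des}(\tau)$; otherwise $\gamma_{n-i}=NE$ if $i=1$ or $i\in\mathrm{Des}(\tau)$; and $\gamma_{n-i}=D$ if $i\notin\mathrm{Des}(\tau)\cup\{1\}$. (If $\mathrm{Des}(\tau)=\{1\}$, the first rule applies to $i=1$.) The map $\Pi_{n,d-1}:\widetilde{\mathrm{Sch}}_{n,d-1,(1)}\to\widetilde{\mathrm{Sch}}_{n,d-1,(1)}$ is the identity if $n-d=1$; if $n-d\ge2$ it is given, for $u\in\{NE,D\}^*$, $v\in\{NE,D\}^*NE$, $i,j\ge0$, by - $uNNEED^jNEv\mapsto uNED^jNNEEv$, - $uNDED^jNEv\mapsto uNED^jNDEv$, - $uNNEED^jNE\mapsto uNED^jNNEE$, - $D^iNEuD^jNNEE\mapsto D^iNNEEuD^jNE$, - $D^iNEuNDED^jNE\mapsto D^iNDEuNED^jNE$. *)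

(* Defs.v *)
From HB Require Import structures.
From mathcomp Require Import all_boot.
From mathcomp Require Import boolp classical_sets functions cardinality.

Set Implicit Arguments.
Unset Strict Implicit.
Unset Printing Implicit Defensive.

Local Open Scope classical_set_scope.
Local Open Scope nat_scope.

Inductive step := N | E | D.

Definition step_code (s : step) : nat :=
  match s with N => 0 | E => 1 | D => 2 end.

Definition step_decode (k : nat) : step :=
  match k with 0 => N | 1 => E | _ => D end.

Lemma step_codeK : cancel step_code step_decode.
Proof. by case. Qed.

HB.instance Definition _ := Countable.copy step (can_type step_codeK).

Definition word := seq step.

Definition NE : word := [:: N; E].
Definition NNEE : word := [:: N; N; E; E].
Definition NDE : word := [:: N; D; E].

(* End point of the path read from (0,0). *)
Definition xcoord (w : word) : nat := count_mem E w + count_mem D w.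
Definition ycoord (w : word) : nat := count_mem N w + count_mem D w.

Definition is_Sch (n d : nat) (w : word) : bool :=
  [&& d <= n, count_mem N w == n - d, count_mem E w == n - d,
      count_mem D w == d
    & all (fun k => count_mem E (take k w) <= count_mem N (take k w))
          (iota 0 (size w).+1)].

(* The subtraction is exact on Schroeder paths.  The term of a step starting at
   (x, y) counts the lower triangles under the path and above the diagonal in
   the row of unit squares crossed by that step. *)
Definition area (w : word) : nat :=
  \sum_(p <- iota 0 (size w) | nth N w p != E)
    (ycoord (take p w) - xcoord (take p w)).

Definition ends_NE (w : word) : bool :=
  has (fun k => suffix (N :: nseq k E) w) (iota 1 (size w)).

Definition tSch1 (n d : nat) : set word :=
  [set w | [/\ is_Sch n d w, ends_NE w & area w = 1]].

Definition east_starts (g : word) : seq (nat * nat) :=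
  [seq (xcoord (take p g), ycoord (take p g)) |
     p <- iota 0 (size g) & nth N g p == E].

(* First height at which the bounce path leaving (j, j) northwards meets the
   starting point of an east step of g. *)
Definition bounce_height (g : word) (j : nat) : nat :=
  j + find (fun y => (j, y) \in east_starts g) (iota j (count_mem N g).+1).

(* The points where the bounce path turns from north to east, starting from
   (j, j).  The turn at (j, y) is followed by the return to the diagonal at
   (y, y); each bounce goes up by at least 1, so count_mem N g rounds suffice. *)
Fixpoint bounce_turns_rec (fuel : nat) (g : word) (j : nat) : seq (nat * nat) :=
  if fuel is fuel'.+1 then
    if j < count_mem N g then
      let y := bounce_height g j in (j, y) :: bounce_turns_rec fuel' g y
    else [::]
  else [::].

Definition bounce_turns (g : word) : seq (nat * nat) :=
  bounce_turns_rec (count_mem N g) g 0.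

Definition bounce_dyck (g : word) : nat :=
  \sum_(t <- bounce_turns g) (count_mem N g - t.2).

Definition Gam (w : word) : word := [seq s <- w | s != D].

(* The step of w at position p is an east step, and the corresponding east step
   of Gam w starts at a north-to-east turn of the bounce path of Gam w. *)
Definition is_peak (w : word) (p : nat) : bool :=
  (nth N w p == E) &&
  ((xcoord (Gam (take p w)), ycoord (Gam (take p w)))
     \in bounce_turns (Gam w)).

Definition numph (w : word) : nat :=
  \sum_(q <- iota 0 (size w) | nth N w q == D) count (is_peak w) (iota 0 q).

Definition bounce (w : word) : nat := bounce_dyck (Gam w) + numph w.

(* A tableau is the sequence of its rows, from bottom to top (French notation),
   each row being read from left to right. *)
Definition tableau := seq (seq nat).

Definition column_strict (r s : seq nat) : bool :=
  all (fun c => nth 0 r c < nth 0 s c) (iota 0 (size s)).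

Definition is_SYT (lam : seq nat) (t : tableau) : bool :=
  [&& shape t == lam, perm_eq (flatten t) (iota 1 (sumn lam)),
      all (sorted ltn) t & sorted column_strict t].

Definition SYT (lam : seq nat) : set tableau := [set t | is_SYT lam t].

Definition hook (n d : nat) : seq nat := d :: nseq (n - d) 1.

Definition row_of (t : tableau) (i : nat) : nat :=
  find (fun r : seq nat => i \in r) t.

Definition Des (t : tableau) : seq nat :=
  [seq i <- iota 1 (size (flatten t)).-1 | row_of t i < row_of t i.+1].

Definition des (t : tableau) : nat := size (Des t).

Definition maj (t : tableau) : nat := \sum_(i <- Des t) i.

Definition S_block (t : tableau) (i : nat) : word :=
  if i == \max_(j <- Des t) j then if 1 \in Des t then NNEE else NDE
  else if (i == 1) || (i \in Des t) then NE
  else [:: D].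

Definition S_map (n : nat) (t : tableau) : word :=
  flatten [seq S_block t (n - k) | k <- iota 1 n.-1].

(* Membership in {NE, D}^*. *)
Fixpoint NEDs (u : word) : bool :=
  match u with
  | [::] => true
  | D :: u' => NEDs u'
  | N :: E :: u' => NEDs u'
  | _ => false
  end.

(* Membership in {NE, D}^* NE. *)
Definition NEDs_NE (v : word) : Prop := exists2 u, NEDs u & v = u ++ NE.

Definition Ds (j : nat) : word := nseq j D.

Inductive Pi_rule : word -> word -> Prop :=
| Pi_rule1 u v j of NEDs u & NEDs_NE v :
    Pi_rule (u ++ NNEE ++ Ds j ++ NE ++ v) (u ++ NE ++ Ds j ++ NNEE ++ v)
| Pi_rule2 u v j of NEDs u & NEDs_NE v :
    Pi_rule (u ++ NDE ++ Ds j ++ NE ++ v) (u ++ NE ++ Ds j ++ NDE ++ v)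
| Pi_rule3 u j of NEDs u :
    Pi_rule (u ++ NNEE ++ Ds j ++ NE) (u ++ NE ++ Ds j ++ NNEE)
| Pi_rule4 u i j of NEDs u :
    Pi_rule (Ds i ++ NE ++ u ++ Ds j ++ NNEE) (Ds i ++ NNEE ++ u ++ Ds j ++ NE)
| Pi_rule5 u i j of NEDs u :
    Pi_rule (Ds i ++ NE ++ u ++ NDE ++ Ds j ++ NE)
            (Ds i ++ NDE ++ u ++ NE ++ Ds j ++ NE).

Lemma NEDs_elim (P : word -> Prop) :
  P [::] -> (forall u, NEDs u -> P u -> P (D :: u)) ->
  (forall u, NEDs u -> P u -> P (N :: E :: u)) -> forall u, NEDs u -> P u.
Proof.
move=> P0 PD PNE u; have [m] := ubnP (size u).
elim: m u => // m IH [|[] u] //=; last by move=> lt_u h; apply: PD => //; exact: IH.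
by case: u => [|[] u] //= lt_u h; apply: PNE => //; apply: IH => //; exact: ltnW.
Qed.

Lemma NEDs_cat u v : NEDs u -> NEDs (u ++ v) = NEDs v.
Proof. by move: u; apply: NEDs_elim. Qed.

Lemma NEDs_Ds j : NEDs (Ds j).
Proof. by elim: j. Qed.

Lemma Ds_NE_inj i j x y :
  Ds i ++ NE ++ x = Ds j ++ NE ++ y -> i = j /\ x = y.
Proof.
elim: i j => [|i IH] [|j] //=; first by case.
by case=> /IH[-> ->].
Qed.

Lemma NEDs_split u1 u2 X1 X2 r1 r2 : NEDs u1 -> NEDs u2 ->
    X1 \in [:: NNEE; NDE] -> X2 \in [:: NNEE; NDE] ->
  u1 ++ X1 ++ r1 = u2 ++ X2 ++ r2 -> [/\ u1 = u2, X1 = X2 & r1 = r2].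
Proof.
move=> h1 h2; rewrite !inE => hX1 hX2.
move: u1 h1 u2 h2; apply: NEDs_elim => [|u1 _ IH|u1 _ IH];
  apply: NEDs_elim => [|u2 h2 _|u2 h2 _] /=;
  try by case/orP: hX1 => /eqP->; case/orP: hX2 => /eqP-> //= [].
all: try by case=> /(IH _ h2)[-> -> ->].
Qed.

Lemma Pi_rule_functional w w1 w2 : Pi_rule w w1 -> Pi_rule w w2 -> w1 = w2.
Proof.
have hA : NNEE \in [:: NNEE; NDE] by [].
have hB : NDE \in [:: NNEE; NDE] by [].
have inj_last x y : x ++ NE = y ++ NE -> x = y.
  by move/(congr1 rev); rewrite !rev_cat => -[] /(can_inj revK).
pose P w w' := exists u X r, [/\ NEDs u, X \in [:: NNEE; NDE], w = u ++ X ++ r &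
  [\/ exists j v, [/\ r = Ds j ++ NE ++ v, v = [::] -> X = NNEE &
         w' = u ++ NE ++ Ds j ++ X ++ v],
      exists i x, [/\ r = [::], u = Ds i ++ NE ++ x &
         w' = Ds i ++ X ++ x ++ NE]
    | exists i j x, [/\ X = NDE, r = Ds j ++ NE, u = Ds i ++ NE ++ x &
         w' = Ds i ++ X ++ x ++ NE ++ Ds j ++ NE]]].
have PP x x' : Pi_rule x x' -> P x x'.
  have hD i y : NEDs y -> NEDs (Ds i ++ NE ++ y) by rewrite NEDs_cat ?NEDs_Ds.
  case=> {x x'}.
  - move=> u v j hu [v' _ ->]; exists u, NNEE, (Ds j ++ NE ++ v' ++ NE).
    by split=> //; constructor 1; exists j, (v' ++ NE).
  - move=> u v j hu [v' _ ->]; exists u, NDE, (Ds j ++ NE ++ v' ++ NE).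
    by split=> //; constructor 1; exists j, (v' ++ NE); split=> //; case: v'.
  - move=> u j hu; exists u, NNEE, (Ds j ++ NE).
    by split=> //; constructor 1; exists j, [::]; rewrite !cats0.
  - move=> u i j hu; exists (Ds i ++ NE ++ u ++ Ds j), NNEE, [::].
    split=> //; first by rewrite hD // NEDs_cat // NEDs_Ds.
      by rewrite -!catA cats0.
    by constructor 2; exists i, (u ++ Ds j); rewrite -!catA.
  - move=> u i j hu; exists (Ds i ++ NE ++ u), NDE, (Ds j ++ NE).
    split=> //; first exact: hD.
      by rewrite -!catA.
    by constructor 3; exists i, j, u.
move=> /PP[u [X [r [hu hX -> H1]]]] /PP[u' [X' [r' [hu' hX' + H2]]]].
case/(NEDs_split hu hu' hX hX') => ???; subst u' X' r'.
have nil j x : Ds j ++ NE ++ x <> [::] by case: j.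
case: H1 => [[j [v [er hv ->]]]|[i [x [er eu ->]]]|[i [j [x [eX er eu ->]]]]];
case: H2 => [[j' [v' [er' hv' ->]]]|[i' [x' [er' eu' ->]]]|[i' [j' [x' [eX' er' eu' ->]]]]].
- by move: er'; rewrite er => /Ds_NE_inj[-> ->].
- by case: (nil j v); rewrite -er.
- move: er'; rewrite er -[in RHS](cats0 NE) => /Ds_NE_inj[_ /hv].
  by rewrite eX'.
- by case: (nil j' v'); rewrite -er'.
- by move: eu'; rewrite eu => /Ds_NE_inj[-> ->].
- by case: (nil j' [::]); rewrite cats0 -er'.
- move: er'; rewrite er -[in LHS](cats0 NE) => /Ds_NE_inj[_ e].
  by move: (hv' (esym e)); rewrite eX.
- by case: (nil j [::]); rewrite cats0 -er.
- move: er'; rewrite er => /inj_last /(congr1 size); rewrite !size_nseq => ->.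
  by move: eu'; rewrite eu => /Ds_NE_inj[-> ->].
Qed.

(* The map Pi_{n, d}; the map Pi_{n, d-1} is Pi_map n d.-1, for which the first
   test reads n - d = 1 when d > 0.  The rules determine at most one image by
   Pi_rule_functional; words to which none of them applies are left fixed. *)
Definition Pi_map (n d : nat) (w : word) : word :=
  if n - d.+1 == 1 then w else xget w [set w' | Pi_rule w w'].

Lemma Pi_mapE n d w w' : n - d.+1 != 1 -> Pi_rule w w' -> Pi_map n d w = w'.
Proof.
move=> nd1 ww'; rewrite /Pi_map (negPf nd1); apply: xget_unique => // w''.
by move=> /Pi_rule_functional; apply.
Qed.

Definition Q_map (n d : nat) (ti : tableau * nat) : word :=
  iter ti.2 (Pi_map n d.-1) (S_map n ti.1).

(* Main.v *)
(** Call the blocks of a path of area 1 other than D its bricks: NE everywhere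
    except for one special brick NNEE or NDE.  Such a path is determined by the
    kind of its special brick, the rank k of that brick among the bricks, and
    the mask b recording which blocks are bricks.  The map Pi keeps the kind
    and b, and, as long as k + 1 < n - d, increases k by one; the paths S(tau)
    are those with k = 0, and a hook tableau tau amounts to a pair (kind, b).
    Hence Q is bijective, and the two cyclic rules of Pi, which send the last
    rank back to 0, are never used.

    With c bricks, bounce = C(c, 2) + inv b + k, where inv b counts the pairs
    (brick, later D block).  For NNEE the D-free path has c + 1 north steps and
    its bounce path returns to the diagonal everywhere except at (k+1, k+1), so
    its bounce is C(c, 2) + k; for NDE its bounce is C(c, 2), and the D of the
    special brick adds k to numph.  Finally maj - des is the sum of i - 1 over
    the descents i, and i - 1 is the number of blocks after the block of i. *)

Require Import Defs.
From mathcomp Require Import all_boot.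
From mathcomp Require Import boolp classical_sets functions cardinality.
From mathcomp Require Import zify.

Set Implicit Arguments.
Unset Strict Implicit.
Unset Printing Implicit Defensive.

Local Open Scope classical_set_scope.
Local Open Scope nat_scope.

(** * Coding words by a kind, a rank and a mask *)

(* In a mask, [true] stands for a brick and [false] for D. *)
Fixpoint plain (b : seq bool) : word :=
  if b is c :: b' then (if c then NE else [:: D]) ++ plain b' else [::].

Definition special (a : bool) : word := if a then NNEE else NDE.

(** [k] counts the bricks before the special one. For [count id b <= k] no brick is special and the
    word degenerates to [plain b], hence the recurring hypothesis [k < count id b]. *)
Fixpoint marked (a : bool) (k : nat) (b : seq bool) : word :=
  match b with
  | [::] => [::]
  | false :: b' => D :: marked a k b'
  | true :: b' => if k is k'.+1 then NE ++ marked a k' b' else special a ++ plain b'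
  end.

Lemma plain_cat b1 b2 : plain (b1 ++ b2) = plain b1 ++ plain b2.
Proof. by elim: b1 => //= c b1 ->; rewrite catA. Qed.

Lemma NEDs_plain b : NEDs (plain b).
Proof. by elim: b => // -[] b. Qed.

Lemma plain_nseq j : plain (nseq j false) = Ds j.
Proof. by elim: j => //= j ->. Qed.

Lemma plain_inj : injective plain.
Proof. by elim=> [|[] b IH] [|[] b'] //= [] /IH ->. Qed.

Lemma marked_cat a k b1 b2 : count id b1 = k ->
  marked a k (b1 ++ true :: b2) = plain b1 ++ special a ++ plain b2.
Proof. by elim: b1 k => [|[] b1 IH] k /= <- //=; rewrite IH. Qed.

Lemma count_id_split k b : k < count id b ->
  exists b1 b2, b = b1 ++ true :: b2 /\ count id b1 = k.
Proof.
elim: b k => // -[] b IH [|k] /= lt_kb.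
- by exists [::], b.
- by have [b1 [b2 [-> <-]]] := IH _ lt_kb; exists (true :: b1), b2.
- by have [b1 [b2 [-> <-]]] := IH _ lt_kb; exists (false :: b1), b2.
- by have [b1 [b2 [-> <-]]] := IH _ lt_kb; exists (false :: b1), b2.
Qed.

Lemma count_id0 b : count id b = 0 -> b = nseq (size b) false.
Proof. by elim: b => // -[] b IH //= /IH {1}->. Qed.

(** The special brick is the first place where the word leaves the blocks NE and D, so [NEDs_split]
    locates it. The plain words on its two sides return the mask, and the bricks of the left one
    return the rank. *)
Lemma marked_inj a a' k k' b b' : k < count id b -> k' < count id b' ->
  marked a k b = marked a' k' b' -> [/\ a = a', k = k' & b = b'].
Proof.
move=> /count_id_split[b1 [b2 [-> <-]]] /count_id_split[b1' [b2' [-> <-]]].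
rewrite !marked_cat // => /NEDs_split[]; rewrite ?NEDs_plain //.
- by case: a; rewrite !inE.
- by case: a'; rewrite !inE.
- by move=> /plain_inj-> + /plain_inj->; case: a a' => -[].
Qed.

(** * Action of [Pi_map] on the rank *)

Lemma plain_NE b : last false b -> NEDs_NE (plain b).
Proof.
case/lastP: b => // b [] ; rewrite last_rcons // => _.
by exists (plain b); rewrite ?NEDs_plain // -cats1 plain_cat.
Qed.

(* [~~ a] because NDE cannot be the last brick. *)
Lemma Pi_rule_marked a k b : last false b -> k.+1 + ~~ a < count id b ->
  Pi_rule (marked a k b) (marked a k.+1 b).
Proof.
move=> lb ltk; have ltk1 : k < count id b by lia.
(* Isolate the special brick and the next brick; the [j] blocks D between them are the factor [Ds j]
   of the rules. *)
have [b1 [b2 [eb ck]]] := count_id_split ltk1.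
have : 0 < count id b2 by move: ltk; rewrite eb count_cat /= ck; lia.
case/count_id_split=> b3 [b4 [eb2 /count_id0]]; move: (size b3) => j eb3.
move: lb ltk; rewrite {}eb {}eb2 {b2}eb3 => lb ltk.
rewrite marked_cat //.
have -> : b1 ++ true :: nseq j false ++ true :: b4 =
          (b1 ++ true :: nseq j false) ++ true :: b4 by rewrite -catA.
rewrite marked_cat ?count_cat /= ?count_nseq ?ck ?addn1 //=.
rewrite !plain_cat /= !plain_nseq -!catA.
(* If the next brick ends the word, the bound on [k] forces NNEE and [Pi_rule3] applies; otherwise
   what follows is a plain word ending in NE. *)
case: (boolP (b4 == [::])) => [/eqP b40|b4n].
  move: ltk; rewrite b40 count_cat /= count_cat count_nseq /= ck.
  case: (a) => [_|]; last by lia.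
  by rewrite !cats0; apply: Pi_rule3 (NEDs_plain _).
have vb4 : NEDs_NE (plain b4).
  apply: plain_NE; move: lb; rewrite !last_cat /= last_cat /=.
  by case: (b4) b4n.
by case: (a); [apply: Pi_rule1|apply: Pi_rule2] => //; exact: NEDs_plain.
Qed.

(** Each iteration is an instance of [Pi_rule_marked], and one iteration already requires
    [1 < n - d.+1], which avoids the identity case of [Pi_map]. *)
Lemma iter_Pi_map n d a b k : last false b -> count id b = n - d.+1 + ~~ a ->
  k < n - d.+1 -> iter k (Pi_map n d) (marked a 0 b) = marked a k b.
Proof.
move=> lb cb; elim: k => // k IH ltk; rewrite iterS IH; last by lia.
by apply: Pi_mapE; [lia|apply: Pi_rule_marked => //; lia].
Qed.

(** * Paths of area 1 *)

(* [h] is the height y - x of the starting point, and the path must end on the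
   diagonal. *)
Fixpoint above_diag (h : nat) (w : word) : bool :=
  match w with
  | [::] => h == 0
  | N :: w' => above_diag h.+1 w'
  | E :: w' => (0 < h) && above_diag h.-1 w'
  | D :: w' => above_diag h w'
  end.

Fixpoint area_from (h : nat) (w : word) : nat :=
  match w with
  | [::] => 0
  | N :: w' => h + area_from h.+1 w'
  | E :: w' => area_from h.-1 w'
  | D :: w' => h + area_from h w'
  end.

Lemma above_diagP h (w : word) :
  all (fun k => count_mem E (take k w) <= h + count_mem N (take k w))
      (iota 0 (size w).+1) && (h + count_mem N w == count_mem E w) =
  above_diag h w.
Proof.
elim: w h => [|s w IH] h; first by rewrite /= !addn0.
rewrite -[size (s :: w)]/(size w).+1 -add1n iotaD all_cat add0n (iotaDl 1 0) all_map.
have: 0 \in iota 0 (size w).+1 by [].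
move: (iota 0 (size w).+1) IH => r IH r0; case: s => /=.
- rewrite -IH; congr (_ && _); last by rewrite add0n addnCA addnA.
  by apply: eq_all => k /=; rewrite !add0n addnCA addnA.
- case: h => [|h].
    (* An E step from height 0 violates the condition on the prefix of length 1, which has index 0
       after the shift. *)
    apply/negbTE; rewrite negb_and; apply/orP; left.
    by apply/allPn; exists 0; rewrite //= take0.
  by rewrite /= -IH; congr (_ && _).
- by rewrite -IH; congr (_ && _); apply: eq_all => k /=; rewrite !add0n.
Qed.

(** The path starts at [(x, x + h)]; with both parameters free, removing any first step yields
    another instance. *)
Lemma area_fromP x h w : above_diag h w ->
  \sum_(p <- iota 0 (size w) | nth N w p != E)
     (x + h + ycoord (take p w) - (x + xcoord (take p w))) = area_from h w.
Proof.
elim: w x h => [|s w IH] x h; first by rewrite big_nil.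
rewrite -[size (s :: w)]/(size w).+1 -add1n iotaD add0n (iotaDl 1 0).
rewrite big_cat big_map big_cons big_nil.
move: (iota 0 (size w)) IH => r IH; rewrite /ycoord /xcoord /= !addn0.
case: s => /= [|/andP[h0]|] hw.
- rewrite -(IH x) //; congr (_ + _); [lia|].
  by apply: eq_bigr => p _; rewrite /xcoord /ycoord /= !add0n; lia.
- rewrite -(IH x.+1) // add0n.
  by apply: eq_bigr => p _; rewrite /xcoord /ycoord /= !add0n; lia.
- rewrite -(IH x.+1) //; congr (_ + _); [lia|].
  by apply: eq_bigr => p _; rewrite /xcoord /ycoord /= !add0n; lia.
Qed.

Lemma area_above_diag w : above_diag 0 w -> area w = area_from 0 w.
Proof. by move=> hw; rewrite -(area_fromP 0 hw). Qed.

Lemma above_diag_plain b : above_diag 0 (plain b).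
Proof. by elim: b => // -[]. Qed.

Lemma area_from_plain b : area_from 0 (plain b) = 0.
Proof. by elim: b => // -[]. Qed.

Lemma above_diag_marked a k b : k < count id b -> above_diag 0 (marked a k b).
Proof.
elim: b k => [|[] b IH] [|k] //= ltk; try exact: IH.
by case: a {IH} => /=; exact: above_diag_plain.
Qed.

Lemma area_from_marked a k b : k < count id b -> area_from 0 (marked a k b) = 1.
Proof.
elim: b k => [|[] b IH] [|k] //= ltk; rewrite ?IH //.
by case: a {IH} => /=; rewrite area_from_plain.
Qed.

(** An N from height 0 must be followed by E, since an N or D from height 1 would add area. *)
Lemma area_from0_plain (w : word) :
  above_diag 0 w -> area_from 0 w = 0 -> exists b, w = plain b.
Proof.
have [m] := ubnP (size w); elim: m w => // m IH [|[|//|] w] /=.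
- by exists [::].
- case: w => [|[||] w] //= ltw hw aw.
  by have [|b ->] := IH w _ hw aw; [exact: ltnW|exists (true :: b)].
- by move=> ltw hw aw; have [//|b ->] := IH w _ hw aw; exists (false :: b).
Qed.

(** The first N or D taken at height 1 uses up the whole area, so the path must then descend to the
    diagonal and go on as a plain word. *)
Lemma area_from1_marked (w : word) : above_diag 0 w -> area_from 0 w = 1 ->
  exists a k b, k < count id b /\ w = marked a k b.
Proof.
have [m] := ubnP (size w); elim: m w => // m IH [|[|//|] w] //=.
- case: w => [|[||] w] //= ltw.
  + case: w ltw => [|[||] w] //= ltw hw.
    case: w ltw hw => [|[||] w] //= ltw hw [aw].
    have [//|b ->] := area_from0_plain hw.
    by exists true, 0, (true :: b).
  + move=> hw aw; have [|a [k [b [ltk ->]]]] := IH w _ hw aw; first exact: ltnW.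
    by exists a, k.+1, (true :: b).
  + case: w ltw => [|[||] w] //= ltw hw [aw].
    have [//|b ->] := area_from0_plain hw.
    by exists false, 0, (true :: b).
- move=> ltw hw aw; have [//|a [k [b [ltk ->]]]] := IH w _ hw aw.
  by exists a, k, (false :: b).
Qed.

Lemma count_plain b :
  [/\ count_mem N (plain b) = count id b, count_mem E (plain b) = count id b
    & count_mem D (plain b) = count negb b].
Proof. by elim: b => //= -[] b [IN IE ID] /=; rewrite IN IE ID; split; lia. Qed.

Lemma count_marked a k b : k < count id b ->
  [/\ count_mem N (marked a k b) = count id b + a,
      count_mem E (marked a k b) = count id b + a
    & count_mem D (marked a k b) = count negb b + ~~ a].
Proof.
elim: b k => [|[] b IH] [|k] //= ltk.
- have [eN eE eD] := count_plain b.
  by rewrite !count_cat eN eE eD; case: (a) => /=; split; lia.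
- by have [-> -> ->] := IH k ltk; split; lia.
- by have [-> -> ->] := IH 0 ltk; split; lia.
- by have [-> -> ->] := IH k.+1 ltk; split; lia.
Qed.

Lemma ends_NE_intro w k : ends_NE (w ++ N :: nseq k.+1 E).
Proof.
apply/hasP; exists k.+1; last exact: suffix_suffix.
by rewrite mem_iota size_cat /= size_nseq; lia.
Qed.

(** Given a final brick, the only failure is NDE in last place, whose D comes after the last N; the
    second conjunct excludes exactly this. *)
Lemma ends_NE_marked a k b : k < count id b ->
  ends_NE (marked a k b) = last false b && (k + ~~ a < count id b).
Proof.
case/count_id_split=> b1 [b2 [-> <-]]; rewrite marked_cat // last_cat count_cat /=.
case/lastP: b2 => [|b2 []].
- rewrite cats0 /= addn0 addn1; case: a => /=.
    have := ends_NE_intro (plain b1 ++ [:: N]) 1; rewrite -catA /= => ->; lia.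
  rewrite addn1 ltnn; apply/negbTE/hasPn => -[|k']; rewrite mem_iota // => _.
  (* Read backwards, the word begins with E, D, and no reversed [N :: nseq k E] does. *)
  rewrite /suffix rev_cat rev_cons rev_nseq -cats1.
  by case: k' => [|k'].
- rewrite last_rcons /= -cats1 plain_cat /= count_cat /= !catA.
  have -> : count id b1 + ~~ a < count id b1 + (1 + (count id b2 + (1 + 0))) by case: a; lia.
  exact: (ends_NE_intro _ 0).
- rewrite last_rcons /= -cats1 plain_cat /= !catA.
  apply/negbTE/hasPn => -[|k']; rewrite mem_iota // => _.
  by rewrite /suffix rev_cat rev_cons rev_nseq.
Qed.

Lemma count_idN b : count id b + count negb b = size b.
Proof. exact: count_predC. Qed.

(** Each block advances by 1 along the diagonal, the special one by 2: hence [n.-1] blocks. NNEE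
    takes two of the [n - d] N steps, while NDE takes one but must not be the last brick, so both
    kinds have [n - d.+1] ranks. *)
Lemma tSch1P n d (w : word) : d < n ->
  tSch1 n d w <-> exists a k b,
    [/\ size b = n.-1, count id b = n - d.+1 + ~~ a, last false b,
        k < n - d.+1 & w = marked a k b].
Proof.
move=> ltdn; split=> [[] /and5P[_ /eqP cN /eqP cE /eqP cD] hw|].
- have {}hw : above_diag 0 w by rewrite -above_diagP hw add0n cN cE eqxx.
  move=> ew; rewrite area_above_diag // => aw.
  have [a [k [b [ltk ew']]]] := area_from1_marked hw aw.
  have := count_marked a ltk; rewrite -ew' cN cE cD => -[cN' _ cD'].
  move: ew; rewrite ew' ends_NE_marked // => /andP[lb ltk'].
  exists a, k, b; have := count_idN b; split => //; case: a {ew'} cN' cD' ltk' => /=; lia.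
- move=> [a [k [b [sb cb lb ltk ->]]]].
  have ltk' : k < count id b by lia.
  have [cN cE cD] := count_marked a ltk'; have cb' := count_idN b.
  have := above_diag_marked a ltk'; rewrite -above_diagP => /andP[hw _].
  split.
  + rewrite /is_Sch cN cE cD; apply/and5P; split=> //; case: (a) cb => /= cb; lia.
  + by rewrite ends_NE_marked // lb cb ltn_add2r.
  + by rewrite area_above_diag ?above_diag_marked // area_from_marked.
Qed.

(** * Bounce paths of words without D *)

Lemma east_starts_cons s w : east_starts (s :: w) =
  (if s == E then [:: (0, 0)] else [::]) ++
  [seq (xcoord [:: s] + t.1, ycoord [:: s] + t.2) | t <- east_starts w].
Proof.
rewrite /east_starts -[size (s :: w)]/(size w).+1 -add1n iotaD add0n (iotaDl 1 0).
rewrite filter_cat map_cat; congr (_ ++ _); first by case: s.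
rewrite filter_map -!map_comp; apply: eq_map => p /=.
by rewrite /xcoord /ycoord /= !addn0; congr (_, _); rewrite addnACA.
Qed.

Lemma east_starts_plain_cat k w : east_starts (plain (nseq k true) ++ w) =
  [seq (i, i.+1) | i <- iota 0 k] ++ [seq (k + t.1, k + t.2) | t <- east_starts w].
Proof.
elim: k => [|k IH] /=.
  by rewrite -[LHS]map_id; apply: eq_map => -[x y].
rewrite !east_starts_cons IH /= !map_cat -!map_comp (iotaDl 1 0) -!map_comp.
by congr (_ :: _).
Qed.

Lemma bounce_heightP g j y : (j, y) \in east_starts g -> j <= y <= j + count_mem N g ->
  (forall y', (j, y') \in east_starts g -> y <= y') -> bounce_height g j = y.
Proof.
move=> jy /andP[lejy leyN] miny; rewrite /bounce_height.
have -> : count_mem N g = (y - j) + (count_mem N g - (y - j)) by lia.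
rewrite -addnS iotaD find_cat size_iota has_find size_iota subnKC //=.
case: ifP => [|_]; last by rewrite jy addn0 subnKC.
rewrite -{2}(size_iota j (y - j)) -has_find => /hasP[y'].
by rewrite mem_iota => lty' /miny; lia.
Qed.

Lemma bounce_turns_rec_run g j f fuel : j + f <= count_mem N g ->
    (forall i, j <= i < j + f -> bounce_height g i = i.+1) ->
  bounce_turns_rec (f + fuel) g j =
  [seq (i, i.+1) | i <- iota j f] ++ bounce_turns_rec fuel g (j + f).
Proof.
elim: f j => [|f IH] j lef hg; first by rewrite addn0.
have ltj : j < count_mem N g by lia.
rewrite addSn /= ltj hg /=; last by lia.
by rewrite IH ?addSnnS // => i hi; apply: hg; lia.
Qed.

Lemma mem_diag_run x y j f :
  ((x, y) \in [seq (i, i.+1) | i <- iota j f]) = (y == x.+1) && (j <= x < j + f).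
Proof.
apply/mapP/andP => [[i]|[/eqP-> hx]]; first by rewrite mem_iota => hi [-> ->].
by exists x; rewrite ?mem_iota.
Qed.

Lemma count_N_plain m : count_mem N (plain (nseq m true)) = m.
Proof. by have [-> _ _] := count_plain (nseq m true); rewrite count_nseq mul1n. Qed.

Lemma bounce_turns_plain m :
  bounce_turns (plain (nseq m true)) = [seq (i, i.+1) | i <- iota 0 m].
Proof.
rewrite /bounce_turns count_N_plain -{1}(addn0 m) bounce_turns_rec_run ?count_N_plain //=.
  by rewrite cats0.
have eg := east_starts_plain_cat m [::]; rewrite !cats0 in eg.
move=> i lti; apply: bounce_heightP; rewrite ?eg ?mem_diag_run ?count_N_plain ?eqxx //; first by lia.
by move=> y'; rewrite mem_diag_run => /andP[/eqP->].
Qed.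

(** What [Gam] leaves of a path with special brick NNEE, [k] bricks before it and [l] after it. *)
Definition one_bump k l : word := plain (nseq k true) ++ NNEE ++ plain (nseq l true).

Lemma count_N_bump k l : count_mem N (one_bump k l) = (k + l).+2.
Proof. by rewrite !count_cat !count_N_plain /= addnCA. Qed.

Lemma mem_east_starts_bump k l x y : ((x, y) \in east_starts (one_bump k l)) =
  [|| (x, y) == (k, k.+2), (x, y) == (k.+1, k.+2)
    | [&& y == x.+1, x < (k + l).+2, x != k & x != k.+1]].
Proof.
rewrite east_starts_plain_cat mem_cat mem_diag_run /NNEE !cat_cons cat0s !east_starts_cons.
have := east_starts_plain_cat l [::]; rewrite !cats0 => ->.
rewrite /= -!map_comp !inE /xcoord /ycoord /=.
set r := (_ \in _).
have -> : r = (y == x.+1) && (k.+2 <= x < k.+2 + l).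
  apply/mapP/andP => [[i]|[/eqP-> hx]].
    by rewrite mem_iota /= => hi [-> ->]; split; lia.
  exists (x - k.+2); first by rewrite mem_iota; lia.
  by congr (_, _) => /=; lia.
by rewrite {r} !xpair_eqE; lia.
Qed.

Lemma bounce_turns_bump k l : bounce_turns (one_bump k l) =
  [seq (i, i.+1) | i <- iota 0 k] ++ (k, k.+2) :: [seq (i, i.+1) | i <- iota k.+2 l].
Proof.
have cN := count_N_bump k l; rewrite /bounce_turns cN.
have height1 i : i < (k + l).+2 -> i != k -> i != k.+1 ->
    bounce_height (one_bump k l) i = i.+1.
  move=> lti ik ik1; apply: bounce_heightP; rewrite ?mem_east_starts_bump ?xpair_eqE ?cN; try lia.
  by move=> y'; rewrite mem_east_starts_bump !xpair_eqE; lia.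
have height2 : bounce_height (one_bump k l) k = k.+2.
  apply: bounce_heightP; rewrite ?mem_east_starts_bump ?cN ?eqxx //; try lia.
  by move=> y'; rewrite mem_east_starts_bump !xpair_eqE; lia.
(* The fuel pays for [k] bounces before the bump, one over it and [l] after it; the last unit meets
   the end of the path. *)
have -> : (k + l).+2 = k + l.+2 by lia.
rewrite bounce_turns_rec_run ?cN; first last.
- by move=> i hi; apply: height1; lia.
- by lia.
have recS f g j : bounce_turns_rec f.+1 g j = if j < count_mem N g then
    (j, bounce_height g j) :: bounce_turns_rec f g (bounce_height g j) else [::] by [].
congr (_ ++ _); rewrite add0n recS cN.
have -> : k < (k + l).+2 by lia.
rewrite height2; congr (_ :: _); rewrite -[l.+1]addn1 bounce_turns_rec_run ?cN; first last.
- by move=> i hi; apply: height1; lia.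
- by lia.
by rewrite /= cN !addSn ltnn cats0.
Qed.

Lemma sum_diag_run j f :
  \sum_(t <- [seq (i, i.+1) | i <- iota j f]) (j + f - t.2) = 'C(f, 2).
Proof.
elim: f j => [|f IH] j; first by rewrite big_nil.
by rewrite /= big_cons /= addnS subSS addKn -addSn IH binS bin1 addnC.
Qed.

Lemma bounce_dyck_plain m : bounce_dyck (plain (nseq m true)) = 'C(m, 2).
Proof. by rewrite /bounce_dyck bounce_turns_plain count_N_plain -(sum_diag_run 0). Qed.

(** Returning at every diagonal point would give ['C((k + l).+2, 2)]; the missing return at
    [(k.+1, k.+1)] takes off [l.+1]. *)
Lemma bounce_dyck_bump k l : bounce_dyck (one_bump k l) = 'C((k + l).+1, 2) + k.
Proof.
rewrite /bounce_dyck bounce_turns_bump count_N_bump big_cat big_cons /=.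
have -> : (k + l).+2 = k.+2 + l by lia.
rewrite sum_diag_run addKn.
(* Generalised over the start [j] of the first run, for induction on [k]. The summand [l] comes from
   the turn [(k, k.+2)], and ['C(l, 2)] from the last run. *)
suff H j : \sum_(t <- [seq (i, i.+1) | i <- iota j k]) (j + (k.+2 + l) - t.2) +
           (l + 'C(l, 2)) = 'C((k + l).+1, 2) + k by exact: (H 0).
elim: k j => [|k IH] j; first by rewrite big_nil add0n addn0 add0n binS bin1 addnC.
rewrite /= big_cons /=.
have -> : j + (k.+3 + l) = j.+1 + (k.+2 + l) by lia.
rewrite -addnA IH addSn (binS (k + l).+1) bin1; lia.
Qed.

(** * Peaks before D steps, and the bounce of a marked word *)

(* [numph] summed over the peaks instead of over the D steps: each peak counts
   the D steps after it.  (x, y) is the current point of the path without D. *)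
Fixpoint peaks_before (P : nat * nat -> bool) (x y : nat) (w : word) : nat :=
  match w with
  | [::] => 0
  | N :: w' => peaks_before P x y.+1 w'
  | E :: w' => P (x, y) * count_mem D w' + peaks_before P x.+1 y w'
  | D :: w' => peaks_before P x y w'
  end.

Lemma peaks_beforeE P x y (w : word) :
  \sum_(q <- iota 0 (size w) | nth N w q == D)
     count (fun p => (nth N w p == E) &&
              P (x + xcoord (Gam (take p w)), y + ycoord (Gam (take p w)))) (iota 0 q)
  = peaks_before P x y w.
Proof.
elim: w x y => [|s w IH] x y; first by rewrite big_nil.
rewrite -[size (s :: w)]/(size w).+1 -add1n iotaD add0n (iotaDl 1 0).
rewrite big_cat big_map big_cons big_nil /= if_same add0n.
under eq_bigr => q _ do rewrite (iotaDl 1 0) count_map.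
case: s => /=.
- rewrite -IH; apply: eq_bigr => q _; rewrite add0n; apply: eq_count => p /=.
  by rewrite /xcoord /ycoord /= !add0n -!addnA (addnA y) addn1.
- rewrite big_split /= -IH; congr (_ + _).
    rewrite big_const_seq iter_addn_0 /xcoord /ycoord /= !addn0; congr (_ * _).
    by rewrite -[in RHS](mkseq_nth N w) count_map.
  apply: eq_bigr => q _; apply: eq_count => p /=.
  by rewrite /xcoord /ycoord /= !add0n -!addnA (addnA x) addn1.
- rewrite -IH; apply: eq_bigr => q _; rewrite add0n; exact: eq_count.
Qed.

Lemma numphE (w : word) :
  numph w = peaks_before (mem (bounce_turns (Gam w))) 0 0 w.
Proof. by rewrite -peaks_beforeE. Qed.

Fixpoint inv_mask (b : seq bool) : nat :=
  if b is c :: b' then c * count negb b' + inv_mask b' else 0.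

Lemma peaks_before_plain (P : nat * nat -> bool) x b :
    (forall i, x <= i < x + count id b -> P (i, i.+1)) ->
  peaks_before P x x (plain b) = inv_mask b.
Proof.
elim: b x => [|[] b IH] x hP //=; last by rewrite IH.
have [_ _ ->] := count_plain b.
by rewrite hP ?IH //= => [i hi|]; [apply: hP|]; move=> /=; lia.
Qed.

(** The D inside NDE precedes its own east step, so it is counted only by the [k] earlier bricks. *)
Lemma peaks_before_NDE (P : nat * nat -> bool) x k b : k < count id b ->
    (forall i, x <= i < x + count id b -> P (i, i.+1)) ->
  peaks_before P x x (marked false k b) = inv_mask b + k.
Proof.
elim: b x k => [|[] b IH] x [|k] //= ltk hP; try by rewrite IH.
  have [_ _ ->] := count_plain b.
  by rewrite hP ?peaks_before_plain //= => [|i hi|]; [|apply: hP|]; move=> /=; lia.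
have [_ _ ->] := count_marked false ltk.
by rewrite hP ?IH //= => [|i hi|]; [|apply: hP|]; move=> /=; lia.
Qed.

(** Only the first of the two east steps of NNEE is a peak, so this brick counts like NE; later
    bricks are shifted by one. *)
Lemma peaks_before_NNEE (P : nat * nat -> bool) x k b : k < count id b ->
    (forall i, x <= i < x + k -> P (i, i.+1)) ->
    P (x + k, (x + k).+2) -> P ((x + k).+1, (x + k).+2) = false ->
    (forall i, (x + k).+2 <= i < (x + count id b).+1 -> P (i, i.+1)) ->
  peaks_before P x x (marked true k b) = inv_mask b.
Proof.
elim: b x k => [|[] b IH] x [|k] //=; try by move=> ? ? ? ?; exact: IH.
  rewrite addn0 => ltk _ -> -> hP; have [_ _ ->] := count_plain b.
  by rewrite peaks_before_plain // => i hi; apply: hP; lia.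
move=> ltk hP1 hP2 hP3 hP4; have [_ _ ->] := count_marked true ltk.
rewrite addnS -addSn in hP2 hP3; rewrite hP1 ?IH /= //; try lia.
- by move=> i hi; apply: hP1; lia.
- by move=> i hi; apply: hP4; lia.
Qed.

Lemma Gam_plain b : Gam (plain b) = plain (nseq (count id b) true).
Proof. by elim: b => // -[] b /= ->. Qed.

Lemma bounce_marked a k b : k < count id b ->
  bounce (marked a k b) = 'C(count id b, 2) + inv_mask b + k.
Proof.
move=> ltk; have [b1 [b2 [eb ck]]] := count_id_split ltk.
have Gm : Gam (marked a k b) = Gam (plain b1) ++ Gam (special a) ++ Gam (plain b2).
  by rewrite eb marked_cat // /Gam !filter_cat.
have cb : count id b = k + (count id b2).+1 by rewrite eb count_cat /= ck.
rewrite /bounce numphE Gm !Gam_plain ck; case: a {Gm} => /=.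
  rewrite -/(one_bump _ _) bounce_dyck_bump cb addnS.
  have mem_turns x y : (x, y) \in bounce_turns (one_bump k (count id b2)) =
      [|| (y == x.+1) && (x < k), (x, y) == (k, k.+2)
        | (y == x.+1) && (k.+2 <= x < k.+2 + count id b2)].
    by rewrite bounce_turns_bump mem_cat inE !mem_diag_run.
  rewrite peaks_before_NNEE /= ?mem_turns ?xpair_eqE //; try lia.
  - by move=> i hi; rewrite /= mem_turns; lia.
  - by move=> i hi; rewrite /= mem_turns; lia.
(* Without its D, NDE becomes NE, so the D-free path is a plain staircase. *)
have -> : plain (nseq k true) ++ N :: E :: plain (nseq (count id b2) true) =
          plain (nseq (count id b) true).
  by rewrite cb nseqD plain_cat.
rewrite bounce_dyck_plain peaks_before_NDE ?addnA // => i hi.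
by rewrite bounce_turns_plain /= mem_diag_run eqxx.
Qed.

(** * Hook tableaux and their descents *)

Definition hook_tab (n : nat) (c : seq nat) : tableau :=
  [seq x <- iota 1 n | x \notin c] :: [seq [:: x] | x <- c].

Lemma flatten_hook_tab n c :
  flatten (hook_tab n c) = [seq x <- iota 1 n | x \notin c] ++ c.
Proof. by rewrite /= flatten_map1 map_id. Qed.

Lemma perm_hook_tab n c : sorted ltn c -> {subset c <= iota 2 n.-1} ->
  perm_eq (flatten (hook_tab n c)) (iota 1 n).
Proof.
move=> sc subc; have uc := sorted_uniq ltn_trans ltnn sc.
rewrite flatten_hook_tab; apply: uniq_perm; rewrite ?iota_uniq //.
  rewrite cat_uniq filter_uniq ?iota_uniq //= uc andbT.
  by apply/hasPn => x xc; rewrite mem_filter xc.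
move=> x; rewrite mem_cat mem_filter; case: (boolP (x \in c)) => [/subc|_].
  by rewrite !mem_iota; lia.
by rewrite orbF.
Qed.

Lemma shape_nseq1 k (t : tableau) : shape t = nseq k 1 ->
  t = [seq [:: x] | x <- flatten t].
Proof. by elim: t k => [|[|x [|y r]] t IH] [|k] //= [st]; rewrite -(IH k). Qed.

Lemma sorted_column_strict (r c : seq nat) :
  sorted column_strict (r :: [seq [:: x] | x <- c]) = path ltn (nth 0 r 0) c.
Proof.
by elim: c r => [|x c IH] r //=; rewrite /column_strict /= andbT; congr (_ && _); exact: IH.
Qed.

(** The corner must hold 1, so the column [c] above it is any set of [n - d] larger entries, and it
    determines the bottom row. *)
Lemma SYT_hookP n d t : 0 < d -> d < n ->
  SYT (hook n d) t <-> exists c, [/\ sorted ltn c, size c = n - d,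
    {subset c <= iota 2 n.-1} & t = hook_tab n c].
Proof.
move=> d0 ltdn; have sumh : sumn (hook n d) = n by rewrite /= sumn_nseq; lia.
rewrite /SYT /= /is_SYT sumh; split.
  case/and4P => /eqP; case: t => [//|r t] [sr st]; have et := shape_nseq1 st.
  move: (flatten t) et => c et; rewrite {t st}et => pt /andP[sr1 _].
  rewrite sorted_column_strict => pc.
  move: pt; rewrite /= flatten_map1 map_id => pt.
  have sc := path_sorted pc.
  have := perm_uniq pt; rewrite iota_uniq cat_uniq => /and3P[_ /hasPn dis _].
  have r0 : nth 0 r 0 \in iota 1 n.
    by rewrite -(perm_mem pt) mem_cat mem_nth ?sr.
  exists c; split=> //.
  - by have := perm_size pt; rewrite size_cat size_iota sr => <-; rewrite addKn.
  - move=> x xc; have : x \in iota 1 n by rewrite -(perm_mem pt) mem_cat xc orbT.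
    move: r0; rewrite !mem_iota.
    by have /allP/(_ x xc) /= := order_path_min ltn_trans pc; lia.
  - congr (_ :: _); apply: (irr_sorted_eq ltn_trans ltnn) => //.
      exact: sorted_filter ltn_trans _ _ (iota_ltn_sorted _ _).
    move=> x; rewrite mem_filter -(perm_mem pt) mem_cat.
    by have /= := dis x; case: (x \in c) => [/(_ isT)/negbTE->|_]; rewrite ?orbF.
case=> c [sc szc subc ->]; have pt := perm_hook_tab sc subc.
have szr : size [seq x <- iota 1 n | x \notin c] = d.
  by have := perm_size pt; rewrite flatten_hook_tab size_cat size_iota szc; lia.
have n1 : 1 \notin c by apply/negP => /subc; rewrite mem_iota.
rewrite pt andTb sorted_column_strict; apply/and3P; split.
- rewrite /shape /= szr -map_comp /hook -szc; apply/eqP; congr (_ :: _).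
  by elim: (c) => //= x c' ->.
- rewrite /= sorted_filter ?iota_ltn_sorted //=; last exact: ltn_trans.
  by elim: (c).
- case: n ltdn subc {sumh pt szr szc} => // n _ subc /=; rewrite n1 /=.
  rewrite (path_sortedE ltn_trans) sc andbT; apply/allP => x /subc.
  by rewrite mem_iota; lia.
Qed.

Lemma row_of_hook_tab n c i : i \in iota 1 n ->
  row_of (hook_tab n c) i = if i \in c then (index i c).+1 else 0.
Proof.
move=> hi; rewrite /row_of /= mem_filter hi andbT; case: (i \in c) => //=.
by rewrite find_map /index; congr _.+1; apply: eq_find => x; rewrite /= inE eq_sym.
Qed.

(** If [i.+1] is in the column, then [i] is lower, being in the bottom row or earlier in the
    increasing column; if not, [i.+1] is in the lowest row. *)
Lemma Des_hook_tab n c : sorted ltn c -> {subset c <= iota 2 n.-1} ->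
  Des (hook_tab n c) = [seq i <- iota 1 n.-1 | i.+1 \in c].
Proof.
move=> sc subc; rewrite /Des (perm_size (perm_hook_tab sc subc)) size_iota.
apply: eq_in_filter => i; rewrite mem_iota => hi.
rewrite !row_of_hook_tab ?mem_iota; try lia.
case: (boolP (i.+1 \in c)) => [i1c|//]; case: (boolP (i \in c)) => // ic.
rewrite ltnS; case: ltngtP => // h.
  by have := sorted_ltn_index ltn_trans sc _ _ i1c ic h; rewrite /= ltnNge leqnSn.
have := nth_index 0 ic; rewrite h nth_index // => e; lia.
Qed.

(** * From tableaux to masks *)

(* The column of a hook tableau is the set of i + 1 with i a descent. *)
Definition mask_of (n : nat) (c : seq nat) : seq bool :=
  [seq (i == 1) || (i.+1 \in c) | i <- rev (iota 1 n.-1)].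

Lemma rev_iota1S k : rev (iota 1 k.+1) = k.+1 :: rev (iota 1 k).
Proof. by have := iotaD 1 k 1; rewrite addn1 => ->; rewrite rev_cat. Qed.

Lemma flatten_plain (f : nat -> bool) s :
  flatten [seq (if f i then NE else [:: D]) | i <- s] = plain [seq f i | i <- s].
Proof. by elim: s => //= i s ->. Qed.

(** Indices are read downwards, so the largest index satisfying [f] gives the first brick, of rank
    0. *)
Lemma flatten_marked (f : nat -> bool) m a k : f m -> 0 < m <= k ->
    (forall i, m < i <= k -> ~~ f i) ->
  flatten [seq (if i == m then special a else if f i then NE else [:: D])
          | i <- rev (iota 1 k)] = marked a 0 [seq f i | i <- rev (iota 1 k)].
Proof.
move=> fm; elim: k => [|k IH] hm hf; first by lia.
rewrite rev_iota1S !map_cons; case: (eqVneq k.+1 m) => [em|nm].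
  rewrite em fm /= -flatten_plain; congr (_ ++ flatten _).
  apply/eq_in_map => i; rewrite mem_rev mem_iota => hi.
  by case: eqP => // eim; lia.
have /negbTE fk : ~~ f k.+1 by apply: hf; lia.
rewrite fk /= IH //; first by lia.
by move=> i hi; apply: hf; lia.
Qed.

Lemma bigmax_seq_mem s : 0 < \max_(i <- s) i -> \max_(i <- s) i \in s.
Proof.
elim: s => [|x s IH]; first by rewrite big_nil.
rewrite big_cons inE; case: (leqP (\max_(i <- s) i) x) => [_|lt_xm _].
  by rewrite eqxx.
by rewrite IH ?orbT //; lia.
Qed.

Lemma S_map_hook_tab n c : sorted ltn c -> {subset c <= iota 2 n.-1} ->
  0 < size c -> S_map n (hook_tab n c) = marked (2 \in c) 0 (mask_of n c).
Proof.
move=> sc subc c0; have eD := Des_hook_tab sc subc.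
have memD i : 0 < i -> (i \in Des (hook_tab n c)) = (i.+1 \in c).
  move=> i0; rewrite eD mem_filter; case: (boolP (i.+1 \in c)) => // /subc.
  by rewrite !mem_iota; lia.
set m := \max_(j <- Des (hook_tab n c)) j.
have le_m i : 0 < i -> i.+1 \in c -> i <= m.
  by move=> i0; rewrite -memD // => iD; exact: leq_bigmax_seq.
have m0 : 0 < m.
  case: (c) c0 subc le_m => // x c' _ /(_ x (mem_head _ _)).
  rewrite mem_iota => hx /(_ x.-1); rewrite prednK; last by lia.
  by rewrite mem_head => /(_ _ isT); lia.
have mc : m.+1 \in c.
  by rewrite -memD //; exact: bigmax_seq_mem.
have ltmn : m < n by have := subc _ mc; rewrite mem_iota; lia.
rewrite -(@flatten_marked _ m) ?mc ?orbT //; first last.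
- move=> i hi; apply/negP => /orP[/eqP|/le_m] h; first by lia.
  by have := h (leq_trans m0 (ltnW (andP hi).1)); lia.
- by lia.
rewrite /S_map; congr flatten.
have -> : rev (iota 1 n.-1) = [seq n - k | k <- iota 1 n.-1].
  apply: (@eq_from_nth _ 0) => [|i]; first by rewrite size_rev size_map.
  rewrite size_rev size_iota => lti.
  by rewrite nth_rev ?(nth_map 0) ?nth_iota ?size_iota //; lia.
rewrite -map_comp; apply/eq_in_map => k; rewrite mem_iota => hk.
by rewrite /S_block -/m !memD //; lia.
Qed.

Lemma maj_Des (f : nat -> bool) k :
  let b := [seq f i | i <- rev (iota 1 k)] in
  \sum_(i <- iota 1 k | f i) i.-1 = 'C(count id b, 2) + inv_mask b.
Proof.
elim: k => [|k IH]; first by rewrite big_nil.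
have e := iotaD 1 k 1; rewrite addn1 in e.
rewrite rev_iota1S e big_cat big_cons big_nil {}IH /=.
(* The new block precedes [k] others: if it is a brick, the later bricks enter the binomial and the
   later D blocks enter [inv_mask]. *)
set b := map _ _; have sb : count id b + count negb b = k.
  by rewrite count_idN size_map size_rev size_iota.
rewrite add1n addn0; case: (f k.+1); rewrite ?mul0n ?mul1n ?add0n ?addn0 //.
by rewrite add1n binS bin1 /=; lia.
Qed.

Lemma maj_sub_des n c : sorted ltn c -> {subset c <= iota 2 n.-1} ->
  maj (hook_tab n c) - des (hook_tab n c) =
  'C(count id (mask_of n c), 2) + inv_mask (mask_of n c).
Proof.
move=> sc subc; rewrite /maj /des Des_hook_tab // -maj_Des.
rewrite big_filter size_filter -sum1_count.
have -> : \sum_(i <- iota 1 n.-1 | i.+1 \in c) i =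
    \sum_(i <- iota 1 n.-1 | i.+1 \in c) i.-1 + \sum_(i <- iota 1 n.-1 | i.+1 \in c) 1.
  rewrite -big_split big_seq_cond [RHS]big_seq_cond; apply: eq_bigr => i /=.
  by rewrite mem_iota; lia.
(* The mask also holds at [i = 1] when 1 is no descent, but there [i.-1] is 0. *)
rewrite addnK big_mkcond [RHS]big_mkcond /=; apply: eq_bigr => i _.
by case: eqP => // ->; case: ifP.
Qed.

Lemma size_mask_of n c : size (mask_of n c) = n.-1.
Proof. by rewrite size_map size_rev size_iota. Qed.

Lemma last_mask_of n c : 1 < n -> last false (mask_of n c).
Proof.
by case: n => [|[|n]] // _; rewrite /mask_of map_rev -[n.+2.-1]/n.+1 /= rev_cons last_rcons.
Qed.

(** Block 1 is a brick even when 1 is no descent, that is, when 2 is not in [c]; this is the extra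
    term. *)
Lemma count_mask_of n c : 1 < n -> sorted ltn c -> {subset c <= iota 2 n.-1} ->
  count id (mask_of n c) = size c + (2 \notin c).
Proof.
case: n => [|[|n]] // _ sc subc.
have ec : c = [seq x <- iota 2 n.+1 | x \in c].
  apply: (irr_sorted_eq ltn_trans ltnn) => //.
    exact: sorted_filter ltn_trans _ _ (iota_ltn_sorted _ _).
  by move=> x; rewrite mem_filter; case: (boolP (x \in c)) => // /subc ->.
rewrite /mask_of count_map count_rev [X in size X]ec size_filter.
rewrite -[n.+2.-1]/n.+1 /= (iotaDl 1 2) count_map.
have -> : count (preim (fun i => (i == 1) || (i.+1 \in c)) id) (iota 2 n) =
          count (preim (addn 1) (fun x => x \in c)) (iota 2 n).
  by apply: eq_in_count => -[|[|i]]; rewrite mem_iota.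
by case: (2 \in c); rewrite ?addn0 ?addn1.
Qed.

(** The mask records every entry except 2, whose membership is the kind of the special brick and is
    given separately. *)
Lemma mask_of_inj n c c' : sorted ltn c -> sorted ltn c' ->
    {subset c <= iota 2 n.-1} -> {subset c' <= iota 2 n.-1} ->
  (2 \in c) = (2 \in c') -> mask_of n c = mask_of n c' -> c = c'.
Proof.
move=> sc sc' subc subc' e2 /eq_in_map em.
apply: (irr_sorted_eq ltn_trans ltnn) => // x.
case: (boolP (x \in iota 2 n.-1)) => [hx|/negP hx]; last first.
  by apply/idP/idP => [/subc|/subc'].
have [->//|x2] := eqVneq x 2; rewrite mem_iota in hx.
have := em x.-1; rewrite mem_rev mem_iota prednK; last by lia.
have -> : (x.-1 == 1) = false by lia.
by apply; lia.
Qed.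

Lemma mask_of_surj n a b : 1 < n -> size b = n.-1 -> last false b ->
  exists c, [/\ sorted ltn c, {subset c <= iota 2 n.-1}, (2 \in c) = a
              & mask_of n c = b].
Proof.
move=> n1 sb lb.
(* The entry [x] corresponds to block [x.-1], at position [x.-2] from the end of [b]; membership of
   2 is free and set to [a]. *)
pose c := [seq x <- iota 2 n.-1 | if x == 2 then a else nth false (rev b) x.-2].
have memc x : (x \in c) = (if x == 2 then a else nth false (rev b) x.-2) && (x \in iota 2 n.-1).
  exact: mem_filter.
exists c; split.
- exact: sorted_filter ltn_trans _ _ (iota_ltn_sorted _ _).
- by move=> x; rewrite memc => /andP[].
- by rewrite memc eqxx mem_iota; case: (a) => //=; lia.
apply: (@eq_from_nth _ false) => [|i]; rewrite size_mask_of // => lti.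
rewrite (nth_map 0) ?size_rev ?size_iota // nth_rev ?size_iota // nth_iota; last by lia.
have -> : 1 + (n.-1 - i.+1) = n.-1 - i by lia.
case: eqP => [ei|ni].
  by move: lb; rewrite -nth_last sb; have -> : n.-1.-1 = i by lia.
rewrite memc mem_iota /= nth_rev sb; last by lia.
have -> : n.-1 - (n.-1 - i).+1.-2.+1 = i by lia.
by case: eqP => [|_]; [lia|case: (nth _ _ _) => //=; lia].
Qed.

(** * Bijectivity and the bounce formula *)

Lemma Q_map_hook_tab n d c i : 0 < d -> d < n -> sorted ltn c ->
    size c = n - d -> {subset c <= iota 2 n.-1} -> i < n - d ->
  Q_map n d (hook_tab n c, i) = marked (2 \in c) i (mask_of n c).
Proof.
move=> d0 ltdn sc szc subc lti; rewrite /Q_map S_map_hook_tab //; last by lia.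
apply: iter_Pi_map; rewrite ?prednK //; first by apply: last_mask_of; lia.
by rewrite count_mask_of ?szc //; lia.
Qed.

Theorem proposition9 (n d : nat) (n_gt0 : 0 < n) (d_gt0 : 0 < d)
    (nd_ge1 : 1 <= n - d) :
  set_bij (SYT (hook n d) `*` `I_(n - d)) (tSch1 n d.-1) (Q_map n d) /\
  (forall (t : tableau) (i : nat),
     SYT (hook n d) t -> i < n - d - 1 ->
     bounce (Q_map n d (t, i)) = maj t - des t + i).
Proof.
have ltdn : d < n by lia.
have ltd1n : d.-1 < n by lia.
have n1 : 1 < n by lia.
have count_mask c : sorted ltn c -> size c = n - d -> {subset c <= iota 2 n.-1} ->
    count id (mask_of n c) = n - d + (2 \notin c).
  by move=> sc szc subc; rewrite count_mask_of // szc.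
split; last first.
  move=> t i /(SYT_hookP _ d_gt0 ltdn)[c [sc szc subc ->]] lti.
  rewrite Q_map_hook_tab //; last by lia.
  by rewrite bounce_marked ?maj_sub_des // count_mask //; lia.
split.
- move=> [t i] /= [/(SYT_hookP _ d_gt0 ltdn)[c [sc szc subc ->]] lti].
  rewrite Q_map_hook_tab //; apply/tSch1P => //; rewrite prednK //.
  exists (2 \in c), i, (mask_of n c).
  by split; rewrite ?size_mask_of ?count_mask ?last_mask_of.
- move=> [t i] [t' i'] /set_mem[/= /(SYT_hookP _ d_gt0 ltdn)[c [sc szc subc ->]] lti].
  move=> /set_mem[/= /(SYT_hookP _ d_gt0 ltdn)[c' [sc' szc' subc' ->]] lti'].
  rewrite !Q_map_hook_tab // => /marked_inj[]; rewrite ?count_mask //; try lia.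
  by move=> e2 -> em; rewrite (mask_of_inj sc sc' subc subc' e2 em).
(* Surjectivity: kind and mask give the column, and the rank gives the number of iterations. *)
- move=> w /(tSch1P _ ltd1n)[a [k [b [sb cb lb ltk ->]]]].
  rewrite prednK // in cb ltk.
  have [c [sc subc ea eb]] := mask_of_surj a n1 sb lb.
  have szc : size c = n - d.
    by have := count_mask_of n1 sc subc; rewrite eb cb ea; lia.
  exists (hook_tab n c, k); last by rewrite Q_map_hook_tab // ea eb.
  by split=> //; apply/SYT_hookP => //; exists c.
Qed.
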